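(* Let $N\ge1$, $p=2N+1$, $b\in\mathbb{T}=\mathbb{R}/(2\pi\mathbb{Z})$, and let $v=(v_k)_1^p\in\mathbb{R}^p$ satisfy $v_1<v_2<\dots<v_p$. Let $H_b(\tau)=\Delta_b+\tau V$, where $\tau\to+\infty$. Then the spectral bands $\sigma_j(\tau v)=[\lambda_j^-(\tau),\lambda_j^+(\tau)]$, $j\in\{-N,\dots,N\}$, of $H_b(\tau)$ have the following asymptotics. With $k=j+N+1$ and $s=(-1)^k$, $$\lambda_j^{\pm s}(\tau)=\tau v_k-\frac{\xi_k^\pm+O(\tau^{-1})}{\tau},\qquad \xi_k^\pm=\frac{r_k^\pm}{v_{k-1}-v_k}+\frac{r_{k+1}^\pm}{v_{k+1}-v_k},$$ where $r_1^\pm=r_{p+1}^\pm=0$ and $r_{2n+1}^\pm=1$, $r_{2n}^-=0$, $r_{2n}^+=4$ for $n\in\{1,\dots,N\}$ (and the terms containing $r_1^\pm$ or $r_{p+1}^\pm$ are absent, i.e. equal to $0$). Here $\lambda_j^{\pm s}$ means $\lambda_j^{\pm}$ if $s=1$ and $\lambda_j^{\mp}$ if $s=-1$. Furthermore, $$|\sigma_j(\tau v)|=\frac{4+O(\tau^{-1})}{\tau\,|v_{k-(-1)^k}-v_k|}\quad (j\ne N,\ k=j+N+1),\qquad |\sigma_N(\tau v)|=O(\tau^{-2}).$$ Moreover, $H_b(\tau)$ has no flat bands for all $\tau$ large enough.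
   Context: Let $\ell^2(\Gamma)$ be the Hilbert space of functions $f=(f_{n,k})_{(n,k)\in\mathbb{Z}\times\{1,\dots,p\}}$ with norm $\|f\|^2=\sum|f_{n,k}|^2$, $p=2N+1$. The operator $\Delta_b$ acts on $\ell^2(\Gamma)$ by $$(\Delta_bf)_{n,2k+1}=e^{-ib(2n+k)}f_{n,2k}+e^{ib(n+2k)}f_{n-1,2k+2}+e^{ib(n-k)}f_{n,2k+2},\quad k\in\{0,1,\dots,N\},$$ $$(\Delta_bf)_{n,2k}=e^{-ib(n-k+1)}f_{n,2k-1}+e^{-ib(n+2k-1)}f_{n+1,2k-1}+e^{ib(2n+k)}f_{n,2k+1},\quad k\in\{1,\dots,N\},$$ for $n\in\mathbb{Z}$, with the Dirichlet convention $f_{n,0}=f_{n,p+1}=0$. The potential acts by $(Vf)_{n,k}=v_kf_{n,k}$. For $t\in[0,2\pi]$ and $u\in\mathbb{R}^p$ let $J_t(b,u)$ be the symmetric $p\times p$ Jacobi matrix with diagonal $u_1,\dots,u_p$ and off-diagonal entries $(J_t)_{n,n+1}=(J_t)_{n+1,n}=a_n$, $1\le n\le p-1$, where $a_n=1$ for $n$ even and $a_n=2|\cos(\frac t2-\frac{3n-2}{2}b)|$ for $n$ odd. Its eigenvalues are $\lambda_{-N}(t,b,u)\le\dots\le\lambda_N(t,b,u)$. The operator $H_b(\tau)$ is unitarily equivalent to $\int^{\oplus}_{[0,2\pi)}J_t(b,\tau v)\frac{dt}{2\pi}$, and its spectral bands are the intervals $\sigma_j(\tau v)=\lambda_j([0,2\pi],b,\tau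 v)$; $\lambda_j^-(\tau)\le\lambda_j^+(\tau)$ denote the lower and upper endpoints of $\sigma_j(\tau v)$. A band $\sigma_j$ is flat if $t\mapsto\lambda_j(t,b,\tau v)$ is constant. $|\cdot|$ of an interval denotes its length. *)

(* Defs.v *)
From HB Require Import structures.
From mathcomp Require Export all_boot all_order all_algebra.
From mathcomp Require Export all_classical all_reals all_analysis.
From mathcomp Require Import spectral complex ring zify.

Set Implicit Arguments.
Unset Strict Implicit.
Unset Printing Implicit Defensive.

Export Order.TTheory GRing.Theory Num.Theory.
Export numFieldNormedType.Exports.

Global Open Scope classical_set_scope.
Global Open Scope ring_scope.

(* Entry of a vector with the 1-based indexing u_1, ..., u_(m+1); for k outside
   this range the value is irrelevant. *)
Definition entry (T : Type) (m : nat) (u : 'rV[T]_m.+1) (k : nat) : T :=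
  u ord0 (inord k.-1).

(* Makes the Landau notation f =O_(+oo_R) g available. *)
Canonical pinfty_filter_on (K : numFieldType) :=
  FilterType (pinfty_nbhs K) (@filter_filter _ _ proper_pinfty_nbhs).

Section Bands.
Variable R : realType.

Definition expi (x : R) : R[i] := Complex (cos x) (sin x).

(* Functions on Z x {1, ..., p}; i : 'I_p stands for the second index i + 1. The
   operators below are given by their formulas on all such functions; they are
   bounded on the square-summable ones. *)
Definition lattice_fun (N : nat) := int -> 'I_(2 * N).+1 -> R[i].

(* f_{n,k}, with the Dirichlet convention f_{n,0} = f_{n,p+1} = 0 *)
Definition site (N : nat) (f : lattice_fun N) (n : int) (k : nat) : R[i] :=
  if (1 <= k <= (2 * N).+1)%N then f n (inord k.-1) else 0.

(* Row i is the index 2k+1 if i + 1 is odd and 2k if i + 1 is even. *)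
Definition magnetic_laplacian (N : nat) (b : R) (f : lattice_fun N) :
    lattice_fun N := fun n i =>
  let k : nat := i.+1./2 in
  let x : R := n%:~R in let y : R := k%:R in
  if odd i.+1 then
    expi (- b * (2 * x + y)) * site f n (2 * k)
    + expi (b * (x + 2 * y)) * site f (n - 1) (2 * k + 2)
    + expi (b * (x - y)) * site f n (2 * k + 2)
  else
    expi (- b * (x - y + 1)) * site f n (2 * k - 1)
    + expi (- b * (x + 2 * y - 1)) * site f (n + 1) (2 * k - 1)
    + expi (b * (2 * x + y)) * site f n (2 * k + 1).

Definition potential (N : nat) (u : 'rV[R]_((2 * N).+1)) (f : lattice_fun N) :
    lattice_fun N := fun n i => real_complex R (u ord0 i) * f n i.

Definition hamiltonian (N : nat) (b : R) (u : 'rV[R]_((2 * N).+1))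
    (f : lattice_fun N) : lattice_fun N :=
  fun n i => magnetic_laplacian b f n i + potential u f n i.

Definition jacobi_offdiag (b t : R) (n : nat) : R :=
  if odd n then 2 * `|cos (t / 2 - (3 * n%:R - 2) / 2 * b)| else 1.

(* The row and column number i : 'I_p stands for the index i + 1. *)
Definition jacobi (N : nat) (b : R) (u : 'rV[R]_((2 * N).+1)) (t : R) :
    'M[R]_((2 * N).+1) :=
  \matrix_(i, j)
    if i == j then u ord0 i
    else if j == i.+1 :> nat then jacobi_offdiag b t i.+1
    else if i == j.+1 :> nat then jacobi_offdiag b t j.+1
    else 0.

Lemma expiD x y : expi (x + y) = expi x * expi y.
Proof. by apply/eqP; rewrite eq_complex /= cosD sinD eqxx /= addrC eqxx. Qed.

Lemma expi0 : expi 0 = 1. Proof. by rewrite /expi cos0 sin0. Qed.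

Lemma expi_cos a x : expi (a + x) + expi (a - x) = real_complex R (2 * cos x) * expi a.
Proof.
by apply/eqP; rewrite eq_complex /= !cosD !sinD cosN sinN; apply/andP; split; apply/eqP; ring.
Qed.

Lemma norm_expi x : `|expi x| = 1.
Proof. by rewrite normc_def /= cos2Dsin2 sqrtr1. Qed.

(* bloch b t n m = e^{int} g_{n,m} theta_m(t), where
   g_{n,m} = e^{ibn(2[m even] - 3 floor(m/2))} and theta_m(t) = gauge b t m are
   unimodular, so that (U f)_m(t) = sum_n (bloch b t n m)^* f_{n,m} is a unitary
   map from l^2(Gamma) onto L^2([0, 2pi), dt/2pi; C^p). By hamiltonian_bloch it
   carries Delta_b + V_u to the multiplication by jacobi b u t, which makes
   jacobi b u the fibres of the operator. *)
Definition gphase (b t : R) (m : nat) : R[i] :=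
  let k : R := m./2%:R in
  let al := t / 2 - (3 * m%:R - 2) / 2 * b in
  if odd m then expi (b * k + al) * (if cos al < 0 then -1 else 1) else expi (- b * k).
Fixpoint gauge (b t : R) (m : nat) : R[i] :=
  if m is m'.+1 then gauge b t m' * gphase b t m' else 1.
Definition bloch (b t : R) (n : int) (m : nat) : R[i] :=
  let k : R := m./2%:R in
  expi (n%:~R * (t + b * ((if odd m then 0 else 2) - 3 * k))) * gauge b t m.

Lemma norm_bloch b t n m : `|bloch b t n m| = 1.
Proof.
rewrite normrM norm_expi mul1r; elim: m => [|m IH] /=; first by rewrite normr1.
rewrite normrM IH mul1r /gphase; case: ifP => _; last by rewrite norm_expi.
by rewrite normrM norm_expi; case: ifP; rewrite ?normrN normr1 mulr1.
Qed.

Lemma bloch_even b t n k : expi (- b * (2 * n%:~R + k%:R)) * bloch b t n (2 * k) = bloch b t n (2 * k).+1.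
Proof.
rewrite /bloch /= /gphase !oddM /= !mul2n doubleK uphalf_double.
rewrite mulrA -expiD [gauge _ _ _ * _]mulrC mulrA -expiD.
congr (expi _ * _); ring.
Qed.

Lemma bloch_even' b t n k : bloch b t n (2 * k) = expi (b * (2 * n%:~R + k%:R)) * bloch b t n (2 * k).+1.
Proof. by rewrite -bloch_even mulrA -expiD mulNr subrr expi0 mul1r. Qed.

Lemma absE (x : R) : real_complex R `|x| = real_complex R x * (if x < 0 then -1 else 1).
Proof.
case: ltrP => h; first by rewrite ltr0_norm// rmorphN mulrN1.
by rewrite ger0_norm// mulr1.
Qed.

Lemma bloch_odd b t n k :
  expi (b * (n%:~R + 2 * k%:R)) * bloch b t (n - 1) (2 * k).+2
  + expi (b * (n%:~R - k%:R)) * bloch b t n (2 * k).+2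
  = real_complex R (jacobi_offdiag b t (2 * k).+1) * bloch b t n (2 * k).+1.
Proof.
rewrite /bloch /= /jacobi_offdiag /= oddM /= mul2n /= ?odd_double /= ?uphalf_double ?doubleK /=.
set K : R := k%:R; set x : R := n%:~R.
rewrite [X in _ = X * _]rmorphM /= absE.
rewrite [gphase b t k.*2.+1]/gphase /= ?odd_double /= ?uphalf_double -/K.
set al := t / 2 - _; set s := if _ then _ else _.
set G := gauge _ _ _ * gphase _ _ _.
pose c := x * (t + b * (0 - 3 * K)).
have alE : al = t / 2 - (6 * K + 1) / 2 * b.
  have e : k.*2.+1%:R = 2 * K + 1 :> R by rewrite -addn1 natrD -muln2 natrM mulrC.
  by rewrite /al e; field.
transitivity ((expi (c - al) + expi (c + al)) * (G * s)).
  rewrite [RHS]mulrDl; congr (_ + _).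
    rewrite [G * (_ * s)]mulrCA !mulrA -!expiD -!mulrA; congr (expi _ * _).
    by rewrite rmorphB /= -/x -[in k.+1%:R]addn1 natrD -/K alE /c; field.
  rewrite [G * (_ * s)]mulrCA !mulrA -!expiD -!mulrA; congr (expi _ * _).
  by rewrite -[in k.+1%:R]addn1 natrD -/K /c; ring.
by rewrite [expi _ + _]addrC expi_cos rmorphM /= -/c; ring.
Qed.

Lemma bloch_odd' b t n k :
  expi (- b * (n%:~R - k%:R)) * bloch b t n (2 * k).+1
  + expi (- b * (n%:~R + 2 * k%:R + 1)) * bloch b t (n + 1) (2 * k).+1
  = real_complex R (jacobi_offdiag b t (2 * k).+1) * bloch b t n (2 * k).+2.
Proof.
rewrite /bloch /= /jacobi_offdiag /= oddM /= mul2n /= ?uphalf_double ?doubleK /=.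
set K : R := k%:R; set x : R := n%:~R.
rewrite [X in _ = X * _]rmorphM /= absE.
rewrite [gphase b t k.*2.+1]/gphase /= ?odd_double /= ?uphalf_double -/K.
set al := t / 2 - _; set s := if _ then _ else _.
have ss : s * s = 1 by rewrite /s; case: ifP => _; rewrite ?mulrNN mulr1.
set G := gauge _ _ _ * gphase _ _ _.
pose c := x * (t + b * (2 - 3 * k.+1%:R)) + (b * K + al).
have alE : al = t / 2 - (6 * K + 1) / 2 * b.
  have e : k.*2.+1%:R = 2 * K + 1 :> R by rewrite -addn1 natrD -muln2 natrM mulrC.
  by rewrite /al e; field.
transitivity ((expi (c - al) + expi (c + al)) * G).
  rewrite [RHS]mulrDl; congr (_ + _); rewrite !mulrA -!expiD; do 2!congr (_ * _); congr (expi _).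
    by rewrite /c -[in k.+1%:R]addn1 natrD -/K; ring.
  by rewrite rmorphD /= -/x /c -[in k.+1%:R]addn1 natrD -/K alE; field.
rewrite [expi _ + _]addrC expi_cos rmorphM /= /c expiD.
transitivity (2%:C%C * (cos al)%:C%C * (expi (x * (t + b * (2 - 3 * k.+1%:R))) * expi (b * K + al)) * G * (s * s)).
  by rewrite ss mulr1.
ring.
Qed.

Lemma sum_delta n (F : 'I_n.+1 -> R[i]) (m : nat) :
  \sum_(j < n.+1) (if j == m :> nat then F j else 0) =
  if (m < n.+1)%N then F (inord m) else 0.
Proof.
case: ltnP => h.
  rewrite (bigD1 (inord m)) //= inordK // eqxx big1 ?addr0 // => j jm.
  case: eqP => // e; case/eqP: jm; apply/val_inj => /=; by rewrite inordK.
by rewrite big1 // => j _; case: eqP => // e; move: (ltn_ord j); rewrite e ltnNge h.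
Qed.

Lemma hamiltonian_bloch (N : nat) (b : R) (u : 'rV[R]_((2 * N).+1)) (t : R)
    (psi : 'cV[R[i]]_((2 * N).+1)) (n : int) (i : 'I_(2 * N).+1) :
  hamiltonian b u (fun m j => bloch b t m j.+1 * psi j ord0) n i
  = bloch b t n i.+1
    * (map_mx (real_complex R) (jacobi b u t) *m psi) i ord0.
Proof.
set f := fun m j => _.
pose ps (k : nat) : R[i] := if (1 <= k <= (2 * N).+1)%N then psi (inord k.-1) ord0 else 0.
have fE m k : site f m k = bloch b t m k * ps k.
  rewrite /site /ps; case: ifP => [/andP[k0 k1]|_]; last by rewrite mulr0.
  by rewrite /f inordK ?prednK.
have JE : (map_mx (real_complex R) (jacobi b u t) *m psi) i ord0 =
    real_complex R (u ord0 i) * psi i ord0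
    + (real_complex R (jacobi_offdiag b t i.+1) * ps i.+2
       + real_complex R (jacobi_offdiag b t i) * ps i).
  rewrite mxE.
  transitivity (\sum_(j < (2 * N).+1)
     ((if j == i :> nat then real_complex R (u ord0 j) * psi j ord0 else 0) +
      ((if j == i.+1 :> nat then real_complex R (jacobi_offdiag b t i.+1) * psi j ord0 else 0) +
      (if j.+1 == i :> nat then real_complex R (jacobi_offdiag b t i) * psi j ord0 else 0)))).
    apply: eq_bigr => j _; rewrite !mxE [j == i :> nat]eq_sym [j.+1 == i]eq_sym.
    case: (eqVneq i j) => [->|ij].
      by rewrite eqxx /= !ifF ?addr0 //; apply/eqP; lia.
    have -> : (i == j :> nat) = false by apply/eqP => /val_inj /eqP; apply/negP.
    rewrite add0r; case: ifP => [/eqP ji|_].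
      by rewrite ifF ?addr0 //; apply/eqP; lia.
    case: ifP => [/eqP ->|_]; by rewrite add0r ?rmorph0 ?mul0r.
  rewrite big_split /= sum_delta ltn_ord inord_val; congr (_ + _).
  rewrite big_split /= sum_delta; congr (_ + _).
    by rewrite /ps /= ltnS; case: ifP; rewrite ?mulr0.
  rewrite /ps; have := ltn_ord i; case: (nat_of_ord i) => [|m] hm.
    by rewrite big1 ?mulr0 //.
  have h : (m < (2 * N).+1)%N := ltnW hm.
  by rewrite sum_delta h /=.
rewrite JE /hamiltonian /potential mulrDr addrC; congr (_ + _).
  by rewrite /f; ring.
rewrite /magnetic_laplacian /=.
have := ltn_ord i; move: (nat_of_ord i) => m _.
have [k [->|->]] : exists k, m = (2 * k)%N \/ m = (2 * k).+1.
  by exists m./2; lia.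
- rewrite oddM /= mul2n uphalf_double -mul2n !fE.
  have L (c0 x0 c1 x1 c2 x2 y z : R[i]) :
      c0 * (x0 * y) + c1 * (x1 * z) + c2 * (x2 * z)
      = (c0 * x0) * y + (c1 * x1 + c2 * x2) * z by ring.
  rewrite !addn2 L bloch_even bloch_odd.
  have -> : jacobi_offdiag b t (2 * k) = 1 by rewrite /jacobi_offdiag oddM.
  by rewrite rmorph1; ring.
- rewrite /= oddM /= mul2n doubleK -mul2n !fE.
  have -> : (2 * k.+1 - 1 = (2 * k).+1)%N by lia.
  have -> : (2 * k.+1 + 1 = (2 * k.+1).+1)%N by lia.
  have L (c0 x0 c1 x1 c2 x2 y z : R[i]) :
      c0 * (x0 * y) + c1 * (x1 * y) + c2 * (x2 * z)
      = (c0 * x0 + c1 * x1) * y + (c2 * x2) * z by ring.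
  have -> : - b * (n%:~R - k.+1%:R + 1) = - b * (n%:~R - k%:R).
    by rewrite -[in k.+1%:R]addn1 natrD; ring.
  have -> : - b * (n%:~R + 2 * k.+1%:R - 1) = - b * (n%:~R + 2 * k%:R + 1).
    by rewrite -[in k.+1%:R]addn1 natrD; ring.
  rewrite L bloch_odd' -bloch_even'.
  have -> : jacobi_offdiag b t (2 * k).+2 = 1 by rewrite /jacobi_offdiag /= oddM.
  have -> : ((2 * k).+3 = (2 * k.+1).+1)%N by lia.
  have -> : (2 * k.+1 = (2 * k).+2)%N by lia.
  by rewrite rmorph1; ring.
Qed.

(* The eigenvalues of A listed in nondecreasing order with multiplicity;
   sorted_eigenvaluesP shows that the default value [::] is never taken when A
   is symmetric. *)
Definition sorted_eigenvalues (n : nat) (A : 'M[R]_n) : seq R :=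
  xget [::] [set s : seq R | sorted <=%O s /\
                             char_poly A = \prod_(x <- s) ('X - x%:P)].

Lemma sorted_eigenvaluesP (n : nat) (A : 'M[R]_n) : A^T = A ->
  [/\ sorted <=%O (sorted_eigenvalues A), size (sorted_eigenvalues A) = n &
      char_poly A = \prod_(x <- sorted_eigenvalues A) ('X - x%:P)].
Proof.
move=> symA.
pose B : 'M[R[i]]_n := map_mx (real_complex R) A.
have hB : B \is hermsymmx.
  apply: realsym_hermsym.
    apply/is_hermitianmxP.
    by rewrite expr0 scale1r map_mx_id ?map_trmx ?symA.
  by apply/mxOverP => i j; rewrite mxE complex_real.
have /orthomx_spectralP EB := hermitian_normalmx hB.
have rD := hermitian_spectral_diag_real hB.
pose d i : R := complex.Re (spectral_diag B ord0 i).
have dE i : spectral_diag B ord0 i = (d i)%:C%C.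
  by rewrite /d RRe_real//; apply: (mxOverP rD).
have cB : char_poly B = \prod_i ('X - ((d i)%:C%C)%:P).
  transitivity (char_poly (diag_mx (spectral_diag B))).
    have uP := spectral_unit B; set P := spectralmx B in EB uP *.
    set D := diag_mx _ in EB *.
    rewrite EB /char_poly.
    pose Q := map_mx (@polyC R[i]) P; pose Q' := map_mx (@polyC R[i]) (invmx P).
    have QQ : Q' *m Q = 1%:M by rewrite -map_mxM mulVmx ?map_mx1.
    have -> : char_poly_mx (invmx P *m D *m P) = Q' *m char_poly_mx D *m Q.
      rewrite /char_poly_mx mulmxBr mulmxBl !map_mxM; congr (_ - _).
      by rewrite mul_mx_scalar -scalemxAl QQ scalemx1.
    by rewrite !det_mulmx mulrAC -det_mulmx QQ det1 mul1r.
  rewrite char_poly_trig ?diag_mx_is_trig//.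
  by apply: eq_bigr => i _; rewrite mxE eqxx mulr1n dE.
have cA : char_poly A = \prod_i ('X - (d i)%:P).
  apply: (map_poly_inj (real_complex R)).
  rewrite map_char_poly cB rmorph_prod/=; apply: eq_bigr => i _.
  by rewrite rmorphB/= map_polyX map_polyC.
have [sE cE] : sorted <=%O (sorted_eigenvalues A) /\
    char_poly A = \prod_(x <- sorted_eigenvalues A) ('X - x%:P).
  apply: (@xgetPex _ [::] [set s : seq R | sorted <=%O s /\
                             char_poly A = \prod_(x <- s) ('X - x%:P)]).
  exists (sort <=%O [seq d i | i <- index_enum 'I_n]); split.
    exact: sort_le_sorted.
  rewrite cA; rewrite (perm_big [seq d i | i <- index_enum _]) ?perm_sort//=.
  by rewrite big_map.
split=> //; apply: succn_inj.
by rewrite -(size_prod_XsubC _ id) -cE size_char_poly.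
Qed.

(* lambda_j(t, b, u) for -N <= j <= N. The bands of Delta_b + tau V are obtained
   for u = tau *: v. *)
Definition band_fun (N : nat) (b : R) (u : 'rV[R]_((2 * N).+1)) (j : int)
    (t : R) : R :=
  (sorted_eigenvalues (jacobi b u t))`_(absz (j + N%:Z)).

Definition band (N : nat) (b : R) (u : 'rV[R]_((2 * N).+1)) (j : int) : set R :=
  band_fun b u j @` `[0, 2 * pi].

(* upper endpoint for e = true, lower endpoint for e = false *)
Definition band_edge (N : nat) (b : R) (u : 'rV[R]_((2 * N).+1)) (j : int)
    (e : bool) : R :=
  if e then sup (band b u j) else inf (band b u j).

Definition band_length (N : nat) (b : R) (u : 'rV[R]_((2 * N).+1)) (j : int) : R :=
  band_edge b u j true - band_edge b u j false.

Definition flat_band (N : nat) (b : R) (u : 'rV[R]_((2 * N).+1)) (j : int) : Prop :=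
  exists c, forall t, t \in `[0, 2 * pi] -> band_fun b u j t = c.

(* r_k^+ for e = true, r_k^- for e = false, 1 <= k <= p + 1 *)
Definition rcoef (N : nat) (e : bool) (k : nat) : R :=
  if (k == 1%N) || (k == (2 * N).+2) then 0
  else if odd k then 1
  else if e then 4 else 0.

(* For k = 1 and k = p the out-of-range term has numerator 0, hence is 0. *)
Definition xicoef (N : nat) (v : 'rV[R]_((2 * N).+1)) (e : bool) (k : nat) : R :=
  rcoef N e k / (entry v k.-1 - entry v k)
  + rcoef N e k.+1 / (entry v k.+1 - entry v k).

End Bands.

(* Main.v *)
Require Import Defs.
From mathcomp Require Import spectral complex ring lra zify.

(** Write jacobi b (tau v) t = tau V + W(t), with V = diag(v) and W(t) a bounded
    symmetric matrix with zero diagonal. Second-order perturbation theory gives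
    an approximate eigenvector of tau V + W(t) for the approximate eigenvalue
    tau v_k - xi_k(t) / tau, where xi_k(t) = sum_i W(t)_ki^2 / (v_i - v_k), with a
    residual O(tau^-2) uniform in t. For a symmetric matrix a residual bounds the
    distance to the spectrum, and since the approximate eigenvalues are ordered
    and separated by a multiple of tau, the k-th eigenvalue is the one
    approximated. The band edges follow by letting the only t-dependent entry in
    xi_k(t), 4 cos^2, run over [0, 4]. For k = p no entry of xi_k(t) depends on
    t; there flatness is excluded by comparing the eigenvector equations at a
    point t where a_(p-2)(t) = 0 and at one where it is not. *)

Set Implicit Arguments.
Unset Strict Implicit.
Unset Printing Implicit Defensive.

(** * From residuals to ordered eigenvalues *)

(** In a unitary eigenbasis the squared residual is the sum of [(d i - mu) ^+ 2 * w i], with [w i]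
    the squared moduli of the coordinates of [psi]. If every eigenvalue were farther than [eps] from
    [mu], it would exceed the assumed bound. *)
Lemma near_eigenvalue (R : realType) n (A : 'M[R]_n) (psi : 'rV[R]_n) (mu eps : R) :
  A^T = A -> 0 <= eps -> psi != 0 ->
  \sum_i (psi *m A - mu *: psi) ord0 i ^+ 2 <= eps ^+ 2 * \sum_i psi ord0 i ^+ 2 ->
  exists2 l, l \in sorted_eigenvalues A & `|l - mu| <= eps.
Proof.
move=> symA eps0 psi0 hres.
have [_ _ cA] := sorted_eigenvaluesP symA.
pose B : 'M[R[i]]_n := map_mx (real_complex R) A.
have hB : B \is hermsymmx.
  apply: realsym_hermsym.
    apply/is_hermitianmxP.
    by rewrite expr0 scale1r map_mx_id ?map_trmx ?symA.
  by apply/mxOverP => i j; rewrite mxE complex_real.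
have /orthomx_spectralP EB := hermitian_normalmx hB.
have rD := hermitian_spectral_diag_real hB.
have uP := spectral_unitarymx B.
set P := spectralmx B in EB uP; set D := spectral_diag B in EB rD.
pose d i : R := complex.Re (D ord0 i).
have dE i : D ord0 i = (d i)%:C%C.
  by rewrite /d RRe_real//; apply: (mxOverP rD).
have PB : P *m B = diag_mx (D) *m P.
  by rewrite EB !mulmxA mulmxV ?mul1mx ?unitarymx_unit.
have dA i : d i \in sorted_eigenvalues A.
  rewrite -root_prod_XsubC -cA -(fmorph_root (real_complex R)) map_char_poly.
  rewrite -eigenvalue_root_char; apply/eigenvalueP; exists (row i P).
    by rewrite -row_mul PB row_mul row_diag_mx -scalemxAl -rowE dE.
  have /row_unitarymxP/(_ i i) := uP; rewrite eqxx => hi.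
  by apply/eqP => h0; move: hi; rewrite h0 dotmxE mul0mx mxE => /eqP; rewrite eq_sym oner_eq0.
pose nrm (u : 'rV[R[i]]_n) : R[i] := \sum_i `|u ord0 i| ^+ 2.
have nrmE u : nrm u = (u *m u ^t*)%sesqui ord0 ord0.
  by rewrite mxE; apply: eq_bigr => i _; rewrite !mxE normCK.
have nrmP u : nrm (u *m P ^t*)%sesqui = nrm u.
  rewrite !nrmE trmx_mul map_mxM /= trmxCK mulmxA mulmxKtV//.
have nrmR (u : 'rV[R]_n) : nrm (map_mx (real_complex R) u) =
    (\sum_i u ord0 i ^+ 2)%:C%C.
  rewrite rmorph_sum; apply: eq_bigr => i _.
  by rewrite mxE rmorphXn /= real_normK// complex_real.
pose y := (map_mx (real_complex R) psi *m P ^t*)%sesqui.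
pose w i : R := complex.Re (`|y ord0 i| ^+ 2).
have wE i : `|y ord0 i| ^+ 2 = (w i)%:C%C.
  by rewrite /w RRe_real//; rewrite rpredX// normr_real.
have w0 i : 0 <= w i by rewrite -(@lecR R) -wE exprn_ge0.
have E1 : \sum_i psi ord0 i ^+ 2 = \sum_i w i.
  apply: (@complexI R); rewrite -nrmR -nrmP rmorph_sum.
  by apply: eq_bigr => i _; rewrite wE.
have E2 : \sum_i (psi *m A - mu *: psi) ord0 i ^+ 2 = \sum_i (d i - mu) ^+ 2 * w i.
  apply: (@complexI R); rewrite -nrmR -nrmP rmorph_sum.
  have -> : (map_mx (real_complex R) (psi *m A - mu *: psi) *m P ^t*)%sesqui
      = y *m diag_mx (D) - (mu%:C)%C *: y.
    rewrite map_mxB map_mxM map_mxZ mulmxBl -scalemxAl -/B EB invmx_unitary//.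
    by rewrite !mulmxA mulmxtVK.
  have shiftE (z : 'rV[R[i]]_n) i :
      (z *m diag_mx D - (mu%:C)%C *: z) ord0 i = ((d i - mu)%:C)%C * z ord0 i.
    by rewrite mul_mx_diag !mxE dE rmorphB /=; ring.
  apply: eq_bigr => i _; rewrite shiftE.
  by rewrite normrM exprMn wE real_normK ?complex_real// rmorphM rmorphXn.
have [/existsP[i hi]|n0] := boolP [exists i, `|d i - mu| <= eps].
  by exists (d i).
exfalso; move: hres; rewrite E1 E2; apply/negP; rewrite -ltNge mulr_sumr.
have n0' i : eps ^+ 2 < (d i - mu) ^+ 2.
  rewrite -[ltRHS]real_normK ?num_real// ltr_pXn2r ?nnegrE//.
  by rewrite ltNge; apply: contra n0 => h; apply/existsP; exists i.
(* Equality in this termwise comparison would force every [w i], hence [psi], to vanish. *)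
rewrite lt_neqAle ler_sum ?andbT; last by move=> i _; rewrite ler_wpM2r// ltW.
apply/eqP => /eqP; rewrite -subr_eq0 -sumrB.
rewrite -oppr_eq0 -sumrN psumr_eq0; last first.
  by move=> i _; rewrite opprB -mulrBl mulr_ge0// subr_ge0 ltW.
move=> /allP h; have wz i : w i = 0.
  have := h i (mem_index_enum i); rewrite /= opprB -mulrBl mulf_eq0 subr_eq0.
  by rewrite gt_eqF//= => /eqP.
move: E1; rewrite [RHS]big1; last by move=> i _; rewrite wz.
move=> /eqP; rewrite psumr_eq0; last by move=> i _; rewrite sqr_ge0.
move=> /allP hp; case/eqP: psi0; apply/rowP => i; rewrite mxE.
by have := hp i (mem_index_enum i); rewrite /= sqrf_eq0 => /eqP.
Qed.

(** Separation makes any choice [f] of nearby positions strictly increasing, and a strictly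
    increasing self-map of ['I_n] is the identity. *)
Lemma sorted_nth_approx (R : realType) (n : nat) (s : seq R) (mu : 'I_n -> R)
    (eps : R) :
  sorted <=%O s -> size s = n ->
  (forall k, exists2 l, l \in s & `|l - mu k| <= eps) ->
  (forall k l : 'I_n, (k < l)%N -> mu k + eps < mu l - eps) ->
  forall k : 'I_n, `|s`_k - mu k| <= eps.
Proof.
move=> s_sorted s_size near_mu sep.
have /choice[f fP] : forall k, exists i : 'I_n, `|s`_i - mu k| <= eps.
  move=> k; have [l ls hl] := near_mu k.
  have li : (index l s < n)%N by rewrite -s_size index_mem.
  by exists (Ordinal li); rewrite /= nth_index.
have f_mono (k l : 'I_n) : (k < l)%N -> (f k < f l)%N.
  move=> kl; rewrite ltnNge; apply/negP => le_f.
  have := le_sorted_leq_nth 0 s_sorted (x := f l) (y := f k).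
  rewrite !inE s_size !ltn_ord => /(_ isT isT le_f).
  have := sep _ _ kl; have := fP k; have := fP l.
  by rewrite !ler_norml => /andP[? ?] /andP[? ?]; lra.
have f_ge (m : nat) (k : 'I_n) : m = k :> nat -> (m <= f k)%N.
  elim: m k => // m IH k mk.
  have km : (m < n)%N by have := ltn_ord k; lia.
  have := IH (Ordinal km) erefl; have := @f_mono (Ordinal km) k.
  by rewrite /= -mk ltnSn => /(_ isT); lia.
have f_le m (k : 'I_n) : (m + k.+1 = n)%N -> (f k <= k)%N.
  elim: m k => [|m IH] k mk; first by have := ltn_ord (f k); lia.
  have km : (k.+1 < n)%N by lia.
  have := IH (Ordinal km); have := @f_mono k (Ordinal km).
  have mk' : (m + k.+2 = n)%N by lia.
  by rewrite /= ltnSn => /(_ isT) ? /(_ mk') ?; lia.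
move=> k; have -> : (k : nat) = f k; last exact: fP.
apply/eqP; rewrite eqn_leq f_ge//= (f_le (n - k.+1)%N)//.
by have := ltn_ord k; lia.
Qed.

Lemma ler_norm_sum_const (R : realType) n (F : 'I_n -> R) c :
  (forall i, `|F i| <= c) -> `|\sum_i F i| <= n%:R * c.
Proof.
move=> Fc; apply: (le_trans (ler_norm_sum _ _ _)).
apply: (le_trans (ler_sum _ (fun i _ => Fc i))).
by rewrite sumr_const card_ord mulr_natl.
Qed.

Lemma ler_norm_divl (R : realType) (x y tau : R) :
  1 <= tau -> `|x| <= y -> `|x / tau| <= y.
Proof.
move=> tau1; apply: le_trans; rewrite normrM ler_piMr//.
by rewrite ger0_norm ?invr_ge0 ?invf_le1//; lra.
Qed.

(** * Second-order perturbation theory with uniform constants *)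

Section SecondOrder.
Variables (R : realType) (n : nat) (v : 'rV[R]_n).

(** A crude common bound for all inverse gaps; the diagonal terms are [0^-1 = 0]. *)
Definition inv_gaps : R := \sum_i \sum_j `|(v ord0 i - v ord0 j)^-1|.

(* The term i = k vanishes because its denominator is 0. *)
Definition second_order (W : 'M[R]_n) (k : 'I_n) : R :=
  \sum_i W k i ^+ 2 / (v ord0 i - v ord0 k).

Lemma inv_gaps_ge0 : 0 <= inv_gaps.
Proof. by apply: sumr_ge0 => i _; apply: sumr_ge0. Qed.

Lemma inv_gaps_ge i j : `|(v ord0 i - v ord0 j)^-1| <= inv_gaps.
Proof.
rewrite /inv_gaps (bigD1 i)//= (bigD1 j)//= -addrA lerDl addr_ge0//.
  exact: sumr_ge0.
by apply: sumr_ge0 => ? _; apply: sumr_ge0.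
Qed.

Lemma inv_gaps_mul_ge1 i j : v ord0 i < v ord0 j ->
  1 <= inv_gaps * (v ord0 j - v ord0 i).
Proof.
rewrite -subr_gt0 => d0; rewrite -ler_pdivrMr// div1r.
by apply: le_trans (inv_gaps_ge j i); rewrite ler_norm.
Qed.

Lemma second_order_le (W : 'M[R]_n) (M : R) k : (forall i j, `|W i j| <= M) ->
  `|second_order W k| <= n%:R * (M ^+ 2 * inv_gaps).
Proof.
move=> WM; apply: ler_norm_sum_const => i.
rewrite normrM normrX ler_pM ?inv_gaps_ge// lerXn2r ?nnegrE//.
exact: le_trans (WM k i).
Qed.

(** The second factor adds up the bounds for [q i], [xi * psi1 i] and [xi * psi2 i] in [quasimode];
    the factor [n] passes from residual entries to the Euclidean norm. *)
Definition quasimode_error (M : R) : R :=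
  n%:R * ((n%:R + n%:R ^+ 2) * inv_gaps ^+ 2 * M ^+ 3
          + n%:R ^+ 2 * inv_gaps ^+ 3 * M ^+ 4).

(* Truncated Rayleigh-Schroedinger series: psi is the eigenvector of
   tau V + W up to order tau^-2, which leaves a residual of that order. *)
Lemma quasimode (W : 'M[R]_n) (M tau : R) (k : 'I_n) :
  (forall i j, i != j -> v ord0 i != v ord0 j) ->
  W^T = W -> (forall i, W i i = 0) -> (forall i j, `|W i j| <= M) -> 1 <= tau ->
  exists2 l, l \in sorted_eigenvalues (tau *: diag_mx v + W) &
    `|l - (tau * v ord0 k - second_order W k / tau)| <= quasimode_error M / tau ^+ 2.
Proof.
move=> v_inj symW W0 WM tau1.
have tau0 : 0 < tau by lra.
have Wsym i j : W i j = W j i by rewrite -[in LHS]symW mxE.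
have M0 : 0 <= M by apply: le_trans (WM k k).
have G0 := inv_gaps_ge0; set G := inv_gaps in G0 *.
pose g i := (v ord0 i - v ord0 k)^-1.
have gG i : `|g i| <= G := inv_gaps_ge i k.
have gk : g k = 0 by rewrite /g subrr invr0.
(* Away from index [k], [psi1] and [psi2] cancel the residual at orders 1 and 1 / [tau]; [g k = 0]
   keeps the [k]-th entry of [psi] equal to 1. *)
pose psi1 i := - (g i * W k i).
pose s i : R := \sum_j psi1 j * W j i.
pose psi2 i := - (g i * s i).
pose q i : R := \sum_j psi2 j * W j i.
set xi := second_order W k; set mu := _ - xi / tau.
(* At index [k] the term of order 1 / [tau] is cancelled by the shift [- xi / tau] in [mu]. *)
have sk : s k = - xi.
  rewrite /s /xi /second_order -sumrN; apply: eq_bigr => i _.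
  by rewrite /psi1 /g (Wsym i k); ring.
have psi1_le i : `|psi1 i| <= G * M by rewrite normrN normrM ler_pM.
have s_le i : `|s i| <= n%:R * (G * M * M).
  by apply: ler_norm_sum_const => j; rewrite normrM ler_pM.
have psi2_le i : `|psi2 i| <= G * (n%:R * (G * M * M)).
  by rewrite normrN normrM ler_pM.
have q_le i : `|q i| <= n%:R * (G * (n%:R * (G * M * M)) * M).
  by apply: ler_norm_sum_const => j; rewrite normrM ler_pM.
have xi_le : `|xi| <= n%:R * (M ^+ 2 * G) by apply: second_order_le.
pose psi : 'rV[R]_n := \row_i ((i == k)%:R + psi1 i / tau + psi2 i / tau ^+ 2).
have psik : psi ord0 k = 1.
  by rewrite mxE eqxx /psi1 /psi2 gk !mul0r !oppr0 !mul0r !addr0.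
set A := tau *: diag_mx v + W.
have symA : A^T = A by rewrite /A linearD linearZ /= tr_diag_mx symW.
pose res i : R := (q i + xi * psi1 i) / tau ^+ 2 + xi * psi2 i / tau ^+ 3.
have resE i : (psi *m A - mu *: psi) ord0 i = res i.
  have psiW : (psi *m W) ord0 i = W k i + s i / tau + q i / tau ^+ 2.
    rewrite mxE /s /q !mulr_suml.
    rewrite -[W k i](_ : \sum_j (j == k)%:R * W j i = _); last first.
      rewrite (bigD1 k)//= eqxx mul1r big1 ?addr0// => j /negPf ->.
      by rewrite mul0r.
    rewrite -!big_split; apply: eq_bigr => j _ /=; rewrite mxE; ring.
  rewrite mulmxDr -scalemxAr mul_mx_diag mxE [X in X + _]mxE psiW.
  rewrite [X in X + _ + _]mxE [X in tau * X]mxE [X in _ + X]mxE [X in - X]mxE.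
  have tauN : tau != 0 by rewrite gt_eqF.
  have -> : 0 = ord0 :> 'I_1 by [].
  have [->|ik] := eqVneq i k.
    by rewrite psik W0 sk /res /mu /psi1 /psi2 gk; field.
  have gN : v ord0 i - v ord0 k != 0 by rewrite subr_eq0 v_inj.
  rewrite mxE (negPf ik) add0r /res /mu /psi2 /psi1 /g; field.
  by rewrite gN tauN.
have res_le i : `|res i| <= ((n%:R + n%:R ^+ 2) * G ^+ 2 * M ^+ 3
          + n%:R ^+ 2 * G ^+ 3 * M ^+ 4) / tau ^+ 2.
  have h1 : `|xi * psi1 i| <= n%:R * (M ^+ 2 * G) * (G * M) by rewrite normrM ler_pM.
  have h2 : `|xi * psi2 i| <= n%:R * (M ^+ 2 * G) * (G * (n%:R * (G * M * M))).
    by rewrite normrM ler_pM.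
  have -> : res i = (q i + xi * psi1 i + xi * psi2 i / tau) / tau ^+ 2.
    by rewrite /res; field; rewrite gt_eqF.
  rewrite normrM [X in _ * X <= _]ger0_norm ?invr_ge0 ?sqr_ge0//.
  rewrite ler_pM2r ?invr_gt0 ?exprn_gt0//.
  have h3 : `|xi * psi2 i / tau| <= `|xi * psi2 i|.
    exact: ler_norm_divl.
  have := ler_normD (q i + xi * psi1 i) (xi * psi2 i / tau).
  have := ler_normD (q i) (xi * psi1 i); have := q_le i.
  lra.
apply: (near_eigenvalue (psi := psi)) => //.
- rewrite divr_ge0 ?sqr_ge0// /quasimode_error mulr_ge0 ?addr_ge0 ?mulr_ge0 ?exprn_ge0//.
- by apply/eqP => h; move: psik; rewrite h mxE => /eqP; rewrite eq_sym oner_eq0.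
rewrite /quasimode_error -/G; set K := _ + _ in res_le *.
(* The [k]-th entry 1 makes the norm of [psi] at least 1. *)
apply: (@le_trans _ _ ((n%:R * K / tau ^+ 2) ^+ 2 * 1)); last first.
  rewrite ler_wpM2l ?sqr_ge0// (bigD1 k)//= psik expr1n lerDl.
  by apply: sumr_ge0 => i _; rewrite sqr_ge0.
rewrite mulr1 (eq_bigr (fun i => res i ^+ 2)); last by move=> i _; rewrite resE.
apply: (le_trans (ler_norm _)).
apply: (@le_trans _ _ (n%:R * (K / tau ^+ 2) ^+ 2)).
  apply: ler_norm_sum_const => i; rewrite normrX lerXn2r ?nnegrE//.
  exact: le_trans (res_le i).
rewrite -[in leRHS]mulrA [leRHS]exprMn ler_wpM2r ?sqr_ge0// expr2 -natrM ler_nat.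
by have := ltn_ord k; nia.
Qed.

(** [C] and [T] depend on the perturbation only through [M], so for [jacobi b 0 t] the estimate is
    uniform in [t]. *)
Lemma eigenvalue_asymptotics (M : R) :
  (forall i j : 'I_n, (i < j)%N -> v ord0 i < v ord0 j) ->
  exists C, exists2 T, 1 <= T & forall tau (W : 'M[R]_n) (k : 'I_n), T < tau ->
    W^T = W -> (forall i, W i i = 0) -> (forall i j, `|W i j| <= M) ->
    `|(sorted_eigenvalues (tau *: diag_mx v + W))`_k
      - (tau * v ord0 k - second_order W k / tau)| <= C / tau ^+ 2.
Proof.
move=> v_incr; exists (quasimode_error M).
pose B := n%:R * (M ^+ 2 * inv_gaps); pose C := quasimode_error M.
have B0 : 0 <= B by rewrite mulr_ge0// mulr_ge0 ?sqr_ge0// inv_gaps_ge0.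
have S0 : 0 <= 2 * B + 2 * `|C| by have := normr_ge0 C; lra.
have T1 : 1 <= 1 + inv_gaps * (2 * B + 2 * `|C|).
  by rewrite lerDl mulr_ge0 ?inv_gaps_ge0.
(* Above this threshold every gap of [tau *: v] exceeds the second-order shifts of two levels, at
   most [B] each, plus their two error radii, at most the modulus of [C] each. *)
exists (1 + inv_gaps * (2 * B + 2 * `|C|)) => // tau W k tauT symW W0 WM.
have tau1 : 1 <= tau by apply: le_trans (ltW tauT).
have v_inj i j : i != j -> v ord0 i != v ord0 j.
  move=> ij; have : (i < j)%N || (j < i)%N by rewrite -neq_ltn.
  by case/orP => /v_incr h; rewrite ?(lt_eqF h)// gt_eqF.
have symA : (tau *: diag_mx v + W)^T = tau *: diag_mx v + W.
  by rewrite linearD linearZ /= tr_diag_mx symW.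
have [sS sz _] := sorted_eigenvaluesP symA.
move: k; apply: (sorted_nth_approx sS sz) => [k|k l kl].
  exact: quasimode.
have d0 := v_incr _ _ kl.
have hk := second_order_le k WM; have hl := second_order_le l WM.
rewrite -/B in hk hl.
have dG := inv_gaps_mul_ge1 d0.
have Cle : `|C / tau ^+ 2| <= `|C|.
  by rewrite expr2 invfM mulrA; do 2!apply: ler_norm_divl => //.
have {}hk := ler_norm_divl tau1 hk; have {}hl := ler_norm_divl tau1 hl.
have key : 2 * B + 2 * `|C| < tau * (v ord0 l - v ord0 k).
  set d := v ord0 l - v ord0 k in dG *; set S := _ + _ in S0 tauT *.
  have d1 : 0 < d by rewrite subr_gt0.
  have h1 : 0 < (tau - (1 + inv_gaps * S)) * d by rewrite mulr_gt0 ?subr_gt0.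
  have h2 : 0 <= S * (inv_gaps * d - 1) by rewrite mulr_ge0 ?subr_ge0.
  rewrite -subr_gt0 (_ : _ - _ = (tau - (1 + inv_gaps * S)) * d
    + S * (inv_gaps * d - 1) + d); last by ring.
  by apply: addr_gt0 => //; apply: ltr_wpDr.
move: hk hl Cle; rewrite -/C !ler_norml => /andP[? ?] /andP[? ?] /andP[? ?].
lra.
Qed.

End SecondOrder.

Lemma sum_ord_delta (V : nmodType) n (F : 'I_n.+1 -> V) (m : nat) :
  \sum_(j < n.+1) (if j == m :> nat then F j else 0) =
  if (m < n.+1)%N then F (inord m) else 0.
Proof.
rewrite -big_mkcond; case: ltnP => h.
  rewrite (big_pred1 (inord m))// => j /=.
  by rewrite -val_eqE /= inordK.
by rewrite big1// => j /eqP e; move: (ltn_ord j); rewrite e ltnNge h.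
Qed.

(** * The Jacobi matrices, their second-order shifts and the band edges *)

Section Jacobi.
Variables (R : realType) (N : nat) (b : R).
Implicit Types (t : R) (i j : 'I_(2 * N).+1) (v : 'rV[R]_(2 * N).+1).

Lemma jacobi_scale (tau : R) v t :
  jacobi b (tau *: v) t = tau *: diag_mx v + jacobi b 0 t.
Proof.
apply/matrixP => i j; rewrite !mxE.
by case: eqVneq => [->|_]; rewrite ?mulr1n ?mulr0n ?mulr0 ?addr0 ?add0r.
Qed.

Lemma tr_jacobi u t : (@jacobi R N b u t)^T = jacobi b u t.
Proof.
apply/matrixP => i j; rewrite !mxE eq_sym; case: eqVneq => [->//|_].
case: ifP => [/eqP ji|_]; last by [].
by rewrite ifF//; apply/eqP; lia.
Qed.

Lemma jacobi0_diag t i : jacobi b 0 t i i = 0.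
Proof. by rewrite !mxE eqxx. Qed.

Lemma jacobi_offdiag_ge0 t m : 0 <= jacobi_offdiag b t m.
Proof. by rewrite /jacobi_offdiag; case: ifP => // _; rewrite mulr_ge0. Qed.

Lemma jacobi_offdiag_le2 t m : jacobi_offdiag b t m <= 2.
Proof.
rewrite /jacobi_offdiag; case: ifP => _; last by lra.
set x := _ - _; have := cos_geN1 x; have := cos_le1 x => ? ?.
have : `|cos x| <= 1 by rewrite ler_norml; apply/andP.
lra.
Qed.

Lemma jacobi0_le2 t i j : `|jacobi b 0 t i j| <= 2.
Proof.
rewrite !mxE; case: ifP => _; first by rewrite normr0.
case: ifP => _; first by rewrite ger0_norm ?jacobi_offdiag_ge0 ?jacobi_offdiag_le2.
case: ifP => _; first by rewrite ger0_norm ?jacobi_offdiag_ge0 ?jacobi_offdiag_le2.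
by rewrite normr0.
Qed.

Lemma jacobi_offdiag_even t m : ~~ odd m -> jacobi_offdiag b t m = 1.
Proof. by rewrite /jacobi_offdiag => /negPf ->. Qed.

(** [f (s - c)] takes opposite values at [s = 0] and [s = pi], so it vanishes in between; then
    [t = 2 * s]. *)
Lemma shifted_zero (f : R -> R) (c : R) : continuous f ->
  f (pi - c) = - f (- c) -> exists2 t, t \in `[0, 2 * pi] & f (t / 2 - c) = 0.
Proof.
move=> cf fpi.
pose g s := f (s - c).
have cg : continuous g.
  move=> x; apply: continuous_comp; last exact: cf.
  by apply: cvgB; [exact: cvg_id | exact: cvg_cst].
have [|s] := @IVT _ g 0 pi 0 (pi_ge0 R) (continuous_subspaceT cg).
  rewrite /g fpi sub0r; case: (lerP 0 (f (- c))) => h.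
    by rewrite min_r ?max_l; lra.
  by rewrite min_l ?max_r; lra.
rewrite in_itv /= => /andP[s0 s1] gs; exists (2 * s).
  by rewrite in_itv /=; apply/andP; split; lra.
by rewrite -gs /g; congr f; field.
Qed.

(** The value 2 occurs at a zero of the sine, the value 0 at a zero of the cosine. *)
Lemma jacobi_offdiag_attained m (e : bool) : odd m ->
  exists2 t, t \in `[0, 2 * pi] & jacobi_offdiag b t m = if e then 2 else 0.
Proof.
move=> om; rewrite /jacobi_offdiag om; set c := _ * b.
case: e.
  have [|t t0 ht] := @shifted_zero sin c (@continuous_sin R).
    by rewrite addrC sinDpi.
  exists t => //; have := cos2Dsin2 (t / 2 - c); rewrite ht expr0n addr0 => h.
  have : `|cos (t / 2 - c)| ^+ 2 = 1 by rewrite real_normK ?num_real.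
  by move/eqP; rewrite sqrp_eq1// => /eqP ->; rewrite mulr1.
have [|t t0 ht] := @shifted_zero cos c (@continuous_cos R).
  by rewrite addrC cosDpi.
by exists t => //; rewrite ht normr0 mulr0.
Qed.

(** A general [F] serves both the squares in [second_order] and the products in the eigenvector
    equation. *)
Lemma sum_jacobi0_row (F : R -> 'I_(2 * N).+1 -> R) t i :
  (forall j, F 0 j = 0) ->
  \sum_j F (jacobi b 0 t i j) j =
  (if (i.+1 < (2 * N).+1)%N then F (jacobi_offdiag b t i.+1) (inord i.+1) else 0)
  + (if (0 < i)%N then F (jacobi_offdiag b t i) (inord i.-1) else 0).
Proof.
move=> F0.
transitivity (\sum_(j < (2 * N).+1)
   ((if j == i.+1 :> nat then F (jacobi_offdiag b t i.+1) j else 0) +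
    (if (0 < i)%N then if j == i.-1 :> nat then F (jacobi_offdiag b t i) j else 0 else 0))).
  apply: eq_bigr => j _; rewrite !mxE.
  case: eqVneq => [->|/eqP ij].
    rewrite F0 ifF ?add0r; last by apply/eqP; lia.
    by case: ifP => // ?; rewrite ifF//; apply/eqP; lia.
  have {}ij : i <> j :> nat by move/val_inj.
  case: ifP => [/eqP ji|_].
    by case: ifP => _; rewrite ?ifF ?addr0//; apply/eqP; lia.
  rewrite add0r; case: ifP => [/eqP e|/eqP e].
    by rewrite e /= eqxx.
  by rewrite F0; case: ifP => // ?; rewrite ifF//; apply/eqP; lia.
rewrite big_split /= sum_ord_delta; congr (_ + _).
case: ifP => i0; last by rewrite big1.
by rewrite sum_ord_delta (leq_ltn_trans (leq_pred i) (ltn_ord i)).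
Qed.

(* r_k(t) = a_(k-1)(t)^2, which ranges over [r_k^-, r_k^+] *)
Definition hop t (k : nat) : R :=
  if (k == 1%N) || (k == (2 * N).+2) then 0 else jacobi_offdiag b t k.-1 ^+ 2.

Lemma second_order_jacobi v t i : second_order v (jacobi b 0 t) i =
  hop t i.+1 / (entry v i - entry v i.+1) + hop t i.+2 / (entry v i.+2 - entry v i.+1).
Proof.
pose F (a : R) j := a ^+ 2 / (v ord0 j - v ord0 i).
rewrite /second_order (sum_jacobi0_row (F := F)); last first.
  by move=> j; rewrite /F expr0n mul0r.
rewrite /entry /= inord_val addrC; congr (_ + _).
  rewrite /hop /=; case: (ltnP 0 i) => i0.
    by rewrite ifF//; have := ltn_ord i; lia.
  by rewrite ifT ?mul0r//; lia.
rewrite /hop /=; case: ltnP => i0.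
  by rewrite ifF//; lia.
by rewrite ifT ?mul0r//; have := ltn_ord i; lia.
Qed.

Lemma hop_odd t e k : odd k -> hop t k = rcoef R N e k.
Proof.
rewrite /hop /rcoef; case: ifP => // /norP[k1 _] ok; rewrite ok jacobi_offdiag_even ?expr1n//.
by case: k k1 ok => //= k; case: (odd k).
Qed.

Lemma hop_ge t k : rcoef R N false k <= hop t k.
Proof.
have [ok|ek] := boolP (odd k); first by rewrite (hop_odd _ false).
by rewrite /rcoef (negPf ek) /hop; case: ifP => // _; rewrite sqr_ge0.
Qed.

Lemma hop_le t k : hop t k <= rcoef R N true k.
Proof.
have [ok|ek] := boolP (odd k); first by rewrite (hop_odd _ true).
rewrite /rcoef (negPf ek) /hop; case: ifP => // _.
by rewrite (_ : 4 = 2 ^+ 2) ?lerXn2r ?nnegrE ?jacobi_offdiag_ge0 ?jacobi_offdiag_le2//; ring.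
Qed.

Lemma hop_attained e k : (0 < k)%N -> ~~ odd k ->
  exists2 t, t \in `[0, 2 * pi] & hop t k = rcoef R N e k.
Proof.
move=> k0 ek; have [|t t0 ht] := @jacobi_offdiag_attained k.-1 e.
  by case: k k0 ek => //= k _; rewrite negbK.
exists t => //; rewrite /hop ht /rcoef (negPf ek); case: ifP => // _.
by case: e {ht}; ring.
Qed.

(** Exactly one of [i.+1] and [i.+2] is even, and only its [hop] can vary with [t]; one choice of
    [t] therefore suffices. *)
Lemma second_order_attained v i e : exists2 t, t \in `[0, 2 * pi] &
  second_order v (jacobi b 0 t) i = xicoef v e i.+1.
Proof.
have [oi|ei] := boolP (odd i).
  have [//|/=|t t0 ht] := @hop_attained e i.+1; first by rewrite oi.
  by exists t => //; rewrite second_order_jacobi ht (hop_odd _ e)//= oi.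
have [//|/=|t t0 ht] := @hop_attained e i.+2; first by rewrite negbK.
by exists t => //; rewrite second_order_jacobi ht (hop_odd _ e).
Qed.

(** The sign of the coefficient of the varying [hop] decides the direction: for even [i.+1] it
    involves the left neighbour and is negative, for odd [i.+1] the right one and is positive. *)
Lemma second_order_bound v i e t :
  (forall k : nat, (1 <= k < (2 * N).+1)%N -> entry v k < entry v k.+1) ->
  if odd i.+1 (+) e then xicoef v e i.+1 <= second_order v (jacobi b 0 t) i
  else second_order v (jacobi b 0 t) i <= xicoef v e i.+1.
Proof.
move=> v_incr; rewrite second_order_jacobi /xicoef /=.
have [oi|ei] := boolP (odd i) => /=.
  have i0 : (0 < i)%N by case: (nat_of_ord i) oi.
  have d0 : (entry v i - entry v i.+1)^-1 < 0.
    by rewrite invr_lt0 subr_lt0 v_incr// i0 /=.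
  rewrite (@hop_odd t e i.+2) /= ?oi//.
  by case: e; rewrite lerD2r ler_wnM2r ?(ltW d0) ?hop_le ?hop_ge.
rewrite (@hop_odd t e i.+1)//.
(* The last index has no right neighbour, so nothing varies and equality holds. *)
have [iN|iN] := leqP (2 * N) i.
  have -> : hop t i.+2 = rcoef R N e i.+2.
    by rewrite /hop /rcoef ifT ?ifT//; have := ltn_ord i; lia.
  by case: e => /=; rewrite lexx.
have d0 : 0 < (entry v i.+2 - entry v i.+1)^-1.
  by rewrite invr_gt0 subr_gt0 v_incr//.
by case: e; rewrite /= lerD2l ler_wpM2r ?(ltW d0) ?hop_le ?hop_ge.
Qed.

(** A uniform error [eps] moves a supremum by at most [eps], and [m] is the attained maximum of
    [F]. *)
Lemma sup_approx (T : Type) (A : set T) (f F : T -> R) (m eps : R) (x0 : T) :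
  A x0 -> F x0 = m -> (forall x, A x -> F x <= m) ->
  (forall x, A x -> `|f x - F x| <= eps) -> `|sup (f @` A) - m| <= eps.
Proof.
move=> Ax0 Fx0 Fm fF.
have ub : ubound (f @` A) (m + eps).
  move=> _ [x Ax <-]; have := Fm _ Ax; have := fF _ Ax.
  by rewrite ler_norml => /andP[? ?]; lra.
have h1 : sup (f @` A) <= m + eps by apply: ge_sup => //; exists (f x0), x0.
have h2 : f x0 <= sup (f @` A) by apply: ub_le_sup; [exists (m + eps) | exists x0].
have := fF _ Ax0; rewrite Fx0 !ler_norml => /andP[? ?]; apply/andP; split; lra.
Qed.

Lemma inf_approx (T : Type) (A : set T) (f F : T -> R) (m eps : R) (x0 : T) :
  A x0 -> F x0 = m -> (forall x, A x -> m <= F x) ->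
  (forall x, A x -> `|f x - F x| <= eps) -> `|inf (f @` A) - m| <= eps.
Proof.
move=> Ax0 Fx0 Fm fF.
have lb : lbound (f @` A) (m - eps).
  move=> _ [x Ax <-]; have := Fm _ Ax; have := fF _ Ax.
  by rewrite ler_norml => /andP[? ?]; lra.
have h1 : m - eps <= inf (f @` A) by apply: lb_le_inf => //; exists (f x0), x0.
have h2 : inf (f @` A) <= f x0 by apply: ge_inf; [exists (m - eps) | exists x0].
have := fF _ Ax0; rewrite Fx0 !ler_norml => /andP[? ?]; apply/andP; split; lra.
Qed.

Lemma entry_incr v :
  (forall k : nat, (1 <= k < (2 * N).+1)%N -> entry v k < entry v k.+1) ->
  forall i j, (i < j)%N -> v ord0 i < v ord0 j.
Proof.
move=> v_incr.
have H d (m : nat) : (m.+1 + d.+1 < (2 * N).+2)%N -> entry v m.+1 < entry v (m.+1 + d.+1)%N.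
  elim: d => [|d IH] h; first by rewrite addn1; apply: v_incr; lia.
  have /IH/lt_trans : (m.+1 + d.+1 < (2 * N).+2)%N by lia.
  by apply; rewrite [(_ + d.+2)%N]addnS; apply: v_incr; lia.
move=> i j ij; have := H (j - i).-1 i.
rewrite (_ : (i.+1 + (j - i).-1.+1 = j.+1)%N); last by lia.
by rewrite /entry /= !inord_val => ->//; have := ltn_ord j; lia.
Qed.

(** Band indices are centred at 0, positions in the sorted spectrum start at 0 and [entry] at 1;
    hence [i - N] next to [i.+1]. *)
Lemma band_fun_asymptotics v :
  (forall k : nat, (1 <= k < (2 * N).+1)%N -> entry v k < entry v k.+1) ->
  exists2 C : R, 0 <= C & exists2 T : R, 1 <= T & forall tau t i, T < tau ->
    `|band_fun b (tau *: v) (i%:Z - N%:Z) t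
      - (tau * entry v i.+1 - second_order v (jacobi b 0 t) i / tau)| <= C / tau ^+ 2.
Proof.
move=> v_incr; have [C [T T1 CT]] := eigenvalue_asymptotics 2 (entry_incr v_incr).
exists `|C| => //; exists T => // tau t i Tt.
rewrite /band_fun subrK /= jacobi_scale /entry /= inord_val.
apply: le_trans (CT _ _ _ Tt (tr_jacobi _ _) (jacobi0_diag _) (jacobi0_le2 t)) _.
by rewrite ler_wpM2r ?invr_ge0 ?sqr_ge0 ?ler_norm.
Qed.

(** [odd i.+1 (+) e] encodes the superscript ±s. The shift enters with a minus sign, so the upper
    edge comes from the minimum of [second_order], the lower one from its maximum. *)
Lemma band_edge_asymptotics v (C tau : R) i e :
  (forall k : nat, (1 <= k < (2 * N).+1)%N -> entry v k < entry v k.+1) ->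
  0 < tau ->
  (forall t, `|band_fun b (tau *: v) (i%:Z - N%:Z) t
      - (tau * entry v i.+1 - second_order v (jacobi b 0 t) i / tau)| <= C) ->
  `|band_edge b (tau *: v) (i%:Z - N%:Z) (odd i.+1 (+) e)
    - (tau * entry v i.+1 - xicoef v e i.+1 / tau)| <= C.
Proof.
move=> v_incr tau0 approx; have [t0 t0I ht0] := second_order_attained v i e.
pose F t := tau * entry v i.+1 - second_order v (jacobi b 0 t) i / tau.
have bnd t := second_order_bound i e t v_incr.
rewrite /band_edge; case: ifP bnd => _ bnd.
- apply: (sup_approx (F := F) (x0 := t0)) => //; first by rewrite /F ht0.
  by move=> t _; rewrite /F lerD2l lerN2 ler_pM2r ?invr_gt0.
- apply: (inf_approx (F := F) (x0 := t0)) => //; first by rewrite /F ht0.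
  by move=> t _; rewrite /F lerD2l lerN2 ler_pM2r ?invr_gt0.
Qed.

End Jacobi.

(** * Non-constancy of the top eigenvalue *)

(** As [c k] dominates the couplings, the moduli of [x k] are nondecreasing, by induction from
    [x 0 = 0]. Row [m], whose term in [x m.+1] vanishes, forces [x m = 0], and monotonicity carries
    this down. *)
Lemma jacobi_recurrence_zero (R : realType) (a c x : nat -> R) (m : nat) :
  x 0%N = 0 -> (forall k, 0 <= a k <= 2) ->
  (forall k, (1 <= k <= m)%N -> 4 <= c k) ->
  (forall k, (1 <= k <= m)%N -> c k * x k = a k * x k.+1 + a k.-1 * x k.-1) ->
  a m * x m.+1 = 0 -> forall k, (k <= m)%N -> x k = 0.
Proof.
move=> x0 a02 c4 rec am0.
have row k : (1 <= k <= m)%N -> `|x k.-1| <= `|x k| ->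
    2 * `|x k| <= `|a k * x k.+1|.
  move=> km hk.
  have h1 : 4 * `|x k| <= `|c k * x k|.
    by rewrite normrM ler_wpM2r// (le_trans (c4 _ km))// ler_norm.
  have h2 : `|a k.-1 * x k.-1| <= 2 * `|x k|.
    have /andP[a0 a2] := a02 k.-1.
    by rewrite normrM ler_pM// ger0_norm.
  by have := ler_normD (a k * x k.+1) (a k.-1 * x k.-1); rewrite -rec//; lra.
have mono k : (k <= m)%N -> `|x k| <= `|x k.+1|.
  elim: k => [|k IH] km; first by rewrite x0 normr0.
  have h := row k.+1 km (IH (ltnW km)).
  have /andP[a0 a2] := a02 k.+1.
  have : `|a k.+1 * x k.+2| <= 2 * `|x k.+2| by rewrite normrM ler_wpM2r// ger0_norm.
  lra.
have xm : x m = 0.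
  case: m c4 rec am0 row mono => [//|m] c4 rec am0 row mono.
  have := row m.+1; rewrite ltnSn => /(_ isT (mono m (leqnSn m))).
  rewrite am0 normr0 => h; apply/eqP; rewrite -normr_le0; lra.
move=> k km; have [d ->] : exists d, k = (m - d)%N by exists (m - k)%N; lia.
elim: d => [|d IH]; first by rewrite subn0.
have [dm|dm] := leqP m d; first by rewrite (_ : m - d.+1 = m - d)%N//; lia.
have := mono (m - d.+1)%N (leq_subr _ _).
rewrite (_ : (m - d.+1).+1 = m - d)%N; last by lia.
by rewrite IH normr0 normr_le0 => /eqP.
Qed.

Section TopBand.
Variables (R : realType) (N : nat) (b : R).
Implicit Types (t : R) (u : 'rV[R]_(2 * N).+1).

(** Padding with zeros at 0 and p + 1 gives every row the same three-term form. *)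
Lemma jacobi_eigenvector u t (l : R) :
  l \in sorted_eigenvalues (jacobi b u t) ->
  exists x : nat -> R, [/\ x 0%N = 0, x (2 * N).+2 = 0,
    (exists2 k, (1 <= k <= (2 * N).+1)%N & x k != 0) &
    forall k, (1 <= k <= (2 * N).+1)%N -> (l - entry u k) * x k =
      jacobi_offdiag b t k * x k.+1 + jacobi_offdiag b t k.-1 * x k.-1].
Proof.
have [_ _ cJ] := sorted_eigenvaluesP (tr_jacobi b u t).
rewrite -root_prod_XsubC -cJ -eigenvalue_root_char => /eigenvalueP[psi psiJ psi0].
pose x (k : nat) : R := if (1 <= k <= (2 * N).+1)%N then psi ord0 (inord k.-1) else 0.
have xS (i : 'I_(2 * N).+1) : x i.+1 = psi ord0 i.
  by rewrite /x /= ltn_ord inord_val.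
exists x; split => //.
- by rewrite /x /= ltnn.
- apply: contrapT => h; case/eqP: psi0; apply/rowP => i; rewrite mxE -xS.
  by apply/eqP; apply: contrapT => /negP xi; apply: h; exists i.+1; rewrite //= ltn_ord.
move=> [//|m] /= mN.
pose i : 'I_(2 * N).+1 := Ordinal mN.
have := congr1 (fun y : 'rV[R]_(2 * N).+1 => y ord0 i) psiJ.
(* Writing [u] as [1 *: u] lets [jacobi_scale] separate the diagonal from the couplings. *)
rewrite -[u in jacobi b u]scale1r jacobi_scale scale1r mulmxDr mul_mx_diag.
rewrite mxE [X in X + _]mxE [X in _ + X]mxE [RHS]mxE.
under eq_bigr => j _ do rewrite -[jacobi b 0 t]tr_jacobi mxE.
rewrite (sum_jacobi0_row b (F := fun a j => psi ord0 j * a)); last first.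
  by move=> j; rewrite mulr0.
rewrite /entry /= (_ : inord m = i); last by apply/val_inj; rewrite /= inordK.
have -> : (if (m.+1 < (2 * N).+1)%N then
    psi ord0 (inord m.+1) * jacobi_offdiag b t m.+1 else 0) =
    jacobi_offdiag b t m.+1 * x m.+2.
  by rewrite /x /= ltnS; case: ifP => _; rewrite ?mulr0// mulrC.
have -> : (if (0 < m)%N then psi ord0 (inord m.-1) * jacobi_offdiag b t m else 0) =
    jacobi_offdiag b t m * x m.
  rewrite /x (ltnW mN) andbT; case: ifP => _; rewrite ?mulr0// mulrC//.
have -> : psi ord0 i = x m.+1 by rewrite -xS.
have -> : u 0 i = u ord0 i by [].
by move=> h; rewrite mulrBl -h; ring.
Qed.

(** At [t0] the matrix splits. The first block cannot have the eigenvalue [l], so the last 2 x 2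
    block, with coupling 1, has it; this is [prod1]. At [t1] the same relation decouples the last
    two rows from the rest, and the eigenvector [y] vanishes. *)
Lemma top_band_not_constant u t0 t1 (l : R) : (1 <= N)%N ->
  (forall k, (1 <= k <= (2 * N).-1)%N -> 4 <= l - entry u k) ->
  jacobi_offdiag b t0 (2 * N).-1 = 0 -> jacobi_offdiag b t1 (2 * N).-1 != 0 ->
  l \in sorted_eigenvalues (jacobi b u t0) ->
  l \in sorted_eigenvalues (jacobi b u t1) -> False.
Proof.
move=> N1 l4 a0 a1 /jacobi_eigenvector[x [x0 xp [k kp xk] recx]].
move=> /jacobi_eigenvector[y [y0 yp [k' kp' yk] recy]].
have a02 t m : 0 <= jacobi_offdiag b t m <= 2.
  by rewrite jacobi_offdiag_ge0 jacobi_offdiag_le2.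
move: (entry u) l4 recx recy => w l4 recx recy.
have [m mE] : exists m, (2 * N = m.+2)%N by exists (2 * N - 2)%N; lia.
rewrite mE /= in x0 xp kp recx yp kp' recy l4 a0 a1.
have em : ~~ odd m by have := oddM 2 N; rewrite mE /= negbK => ->.
have a_even t : jacobi_offdiag b t m.+2 = 1 by rewrite jacobi_offdiag_even//= negbK.
have xz : forall j, (j <= m.+1)%N -> x j = 0.
  apply: (jacobi_recurrence_zero (a := jacobi_offdiag b t0) (c := fun j => l - w j)) => //.
    by move=> j jm; apply: recx; lia.
  by rewrite a0 mul0r.
have X2 : (l - w m.+2) * x m.+2 = x m.+3.
  by have := recx m.+2; rewrite /= a_even a0 mul1r mul0r addr0 => -> //; lia.
have X3 : (l - w m.+3) * x m.+3 = x m.+2.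
  by have := recx m.+3; rewrite /= a_even xp mul1r mulr0 add0r => -> //; lia.
have prod1 : (l - w m.+2) * (l - w m.+3) = 1.
  have [x3|x3] := eqVneq (x m.+3) 0.
    case/eqP: xk; have [/xz//|km] := leqP k m.+1.
    have [->|->] : k = m.+2 \/ k = m.+3 by lia.
      by rewrite -X3 x3 mulr0.
    exact: x3.
  by apply: (mulIf x3); rewrite -mulrA X3 mul1r.
have Y3 : (l - w m.+3) * y m.+3 = y m.+2.
  by have := recy m.+3; rewrite /= a_even yp mul1r mulr0 add0r => -> //; lia.
have Y2 : (l - w m.+2) * y m.+2 = y m.+3 + jacobi_offdiag b t1 m.+1 * y m.+1.
  by have := recy m.+2; rewrite /= a_even mul1r => -> //; lia.
(* Eliminating [y m.+2] between [Y2] and [Y3] and using [prod1] leaves only the coupling term. *)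
have ym1 : y m.+1 = 0.
  apply: (mulfI a1); rewrite mulr0.
  by apply: (addrI (y m.+3)); rewrite -Y2 -Y3 mulrA prod1 mul1r addr0.
have yz : forall j, (j <= m)%N -> y j = 0.
  apply: (jacobi_recurrence_zero (a := jacobi_offdiag b t1) (c := fun j => l - w j)) => //.
  - by move=> j jm; apply: l4; lia.
  - by move=> j jm; apply: recy; lia.
  - by rewrite ym1 mulr0.
(* Row [m.+1] now reduces to its coupling with [y m.+2]. *)
have ym2 : y m.+2 = 0.
  apply: (mulfI a1); have := recy m.+1; rewrite /= ym1 (yz m)// !mulr0 addr0 => <- //; lia.
have ym3 : y m.+3 = 0.
  by have := Y2; rewrite ym2 ym1 !mulr0 addr0.
case/eqP: yk; have [/yz//|km] := leqP k' m.
have [->|[->|->]] : k' = m.+1 \/ k' = m.+2 \/ k' = m.+3 by lia.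
all: by [].
Qed.

End TopBand.

(** * Band lengths *)

Section Asymptotics.
Variables (R : realType) (N : nat) (b : R) (v : 'rV[R]_(2 * N).+1).
Hypothesis v_incr :
  forall k : nat, (1 <= k < (2 * N).+1)%N -> entry v k < entry v k.+1.

(** In [band_edge_asymptotics] the sign [odd i.+1] gives the lower edge, its negation the upper
    one. *)
Lemma band_length_asymptotics (C tau : R) (i : 'I_(2 * N).+1) : 0 < tau ->
  (forall t, `|band_fun b (tau *: v) (i%:Z - N%:Z) t
      - (tau * entry v i.+1 - second_order v (jacobi b 0 t) i / tau)| <= C) ->
  `|band_length b (tau *: v) (i%:Z - N%:Z)
    - (xicoef v (odd i.+1) i.+1 - xicoef v (~~ odd i.+1) i.+1) / tau| <= 2 * C.
Proof.
move=> tau0 approx; rewrite /band_length.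
have := band_edge_asymptotics (odd i.+1) v_incr tau0 approx.
have := band_edge_asymptotics (~~ odd i.+1) v_incr tau0 approx.
rewrite addbb addbN addbb /= mulrBl !ler_norml => /andP[? ?] /andP[? ?].
by apply/andP; split; lra.
Qed.

(** The term with an odd index is the same for both signs and cancels; the other contributes 4 - 0
    over the gap to [entry v k']. *)
Lemma xicoef_gap (i : 'I_(2 * N).+1) : (i < 2 * N)%N ->
  let k' := if odd i.+1 then i.+2 else i in
  xicoef v (odd i.+1) i.+1 - xicoef v (~~ odd i.+1) i.+1 =
  4 / `|entry v k' - entry v i.+1|.
Proof.
move=> iN; rewrite /= /xicoef /rcoef /=.
have [oi|ei] := boolP (odd i) => /=; rewrite ?oi ?(negPf ei) /=.
  have i0 : (0 < i)%N by case: (nat_of_ord i) oi.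
  rewrite !(ifF (b := (_ == _) || (_ == _))); try lia.
  have d0 : entry v i - entry v i.+1 < 0 by rewrite subr_lt0 v_incr//; lia.
  by rewrite ltr0_norm// opprD addrACA subrr addr0 mul0r sub0r invrN mulrN.
have d0 : 0 < entry v i.+2 - entry v i.+1 by rewrite subr_gt0 v_incr//; lia.
rewrite (_ : (i.+2 == (2 * N).+2) = false); last by lia.
by rewrite gtr0_norm// opprD addrACA subrr add0r mul0r subr0.
Qed.

Lemma entry_gap_gt0 (i : 'I_(2 * N).+1) : (i < 2 * N)%N ->
  let k' := if odd i.+1 then i.+2 else i in 0 < `|entry v k' - entry v i.+1|.
Proof.
move=> iN /=; rewrite normr_gt0 subr_eq0; have [oi|ei] := boolP (odd i) => /=.
  by rewrite lt_eqF// v_incr//; case: (nat_of_ord i) oi iN => //; lia.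
by rewrite gt_eqF// v_incr//; lia.
Qed.

Lemma entry_lt_last (i : 'I_(2 * N).+1) k : i = (2 * N)%N :> nat ->
  (1 <= k <= (2 * N).-1)%N -> v ord0 (inord k.-1) < v ord0 i.
Proof. by move=> iE kN; apply: entry_incr => //; rewrite inordK; lia. Qed.

(** As p is odd, r_p does not depend on the sign, and r_(p+1) = 0; so the leading term of the top
    band length cancels. *)
Lemma xicoef_last (e e' : bool) : xicoef v e (2 * N).+1 = xicoef v e' (2 * N).+1.
Proof. by rewrite /xicoef /rcoef /= !eqxx /= oddM. Qed.

End Asymptotics.

(** * Landau estimates and absence of flat bands *)

Lemma bigO_pinfty (R : realType) (f g : R -> R) (C T : R) :
  (forall tau, T < tau -> `|f tau| <= C * `|g tau|) -> f =O_ (+oo_R) g.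
Proof.
move=> fg; apply/eqO_exP; exists (`|C| + 1); first by rewrite ltr_wpDl.
near=> tau; apply: (le_trans (fg tau _)).
  by near: tau; apply: nbhs_pinfty_gt; rewrite num_real.
by rewrite ler_wpM2r// (le_trans (ler_norm C))// lerDl.
Unshelve. all: by end_near. Qed.

Lemma band_index (N : nat) (j : int) : - N%:Z <= j <= N%:Z ->
  exists2 i : 'I_(2 * N).+1, j = i%:Z - N%:Z & absz (j + N%:Z + 1) = i.+1.
Proof.
move=> jN; have h : (absz (j + N%:Z)%R < (2 * N).+1)%N by lia.
by exists (Ordinal h) => /=; lia.
Qed.

Theorem theorem1p5 (R : realType) (N : nat) (b : R) (v : 'rV[R]_((2 * N).+1))
    (N_ge1 : (1 <= N)%N)
    (v_incr : forall k : nat, (1 <= k < (2 * N).+1)%N ->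
                entry v k < entry v k.+1) :
  [/\ (forall (j : int) (e : bool), - N%:Z <= j <= N%:Z ->
         let k := absz (j + N%:Z + 1) in
         exists2 h : R -> R, h =O_ (+oo_R) (fun tau => tau^-1) &
           \forall tau \near +oo,
             band_edge b (tau *: v) j (if odd k then ~~ e else e)
             = tau * entry v k - (xicoef v e k + h tau) / tau),
      (forall j : int, - N%:Z <= j < N%:Z ->
         let k := absz (j + N%:Z + 1) in
         let k' := if odd k then k.+1 else k.-1 in
         exists2 h : R -> R, h =O_ (+oo_R) (fun tau => tau^-1) &
           \forall tau \near +oo,
             band_length b (tau *: v) j
             = (4 + h tau) / (tau * `|entry v k' - entry v k|)),
      (fun tau : R => band_length b (tau *: v) N%:Z) =O_ (+oo_R) (fun tau => tau ^- 2) &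
      \forall tau \near +oo, forall j : int, - N%:Z <= j <= N%:Z ->
        ~ flat_band b (tau *: v) j].
Proof.
have [C C0 [T T1 approx]] := band_fun_asymptotics b v_incr.
have tau_gt0 tau : T < tau -> 0 < tau by move=> ?; lra.
have length_approx tau i (Tt : T < tau) :=
  band_length_asymptotics v_incr (tau_gt0 _ Tt) (fun t => approx tau t i Tt).
have edge_approx tau i e (Tt : T < tau) :=
  band_edge_asymptotics e v_incr (tau_gt0 _ Tt) (fun t => approx tau t i Tt).
split.
- move=> j e jN /=; have [i -> ->] := band_index jN.
  pose edge tau := band_edge b (tau *: v) (i%:Z - N%:Z) (odd i.+1 (+) e).
  have -> : (if odd i.+1 then ~~ e else e) = odd i.+1 (+) e by case: odd.
  (* [h] solves the required identity; the factor [tau] turns the edge error [C / tau ^+ 2] into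
     [C / tau]. *)
  exists (fun tau => tau * (tau * entry v i.+1 - edge tau) - xicoef v e i.+1).
    apply: (bigO_pinfty (C := C) (T := T)) => tau Tt; have t0 := tau_gt0 _ Tt.
    rewrite [`|tau^-1|]gtr0_norm ?invr_gt0//.
    rewrite (_ : _ - _ = - tau * (edge tau - (tau * entry v i.+1 - xicoef v e i.+1 / tau))).
      rewrite normrM normrN [`|tau|]gtr0_norm// mulrC -ler_pdivlMr// -mulrA -invfM -expr2.
      exact: edge_approx.
    by field; rewrite gt_eqF.
  exists T; split; first exact: num_real.
  by move=> tau /tau_gt0 t0; rewrite -/(edge tau); field; rewrite gt_eqF.
- move=> j /andP[jN jN'] /=.
  have [|i jE ->] := @band_index N j; first by rewrite jN ltW.
  have iN : (i < 2 * N)%N by move: jN'; rewrite jE; lia.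
  rewrite jE /=; set k' := if _ then _ else _.
  have gap : xicoef v (odd i.+1) i.+1 - xicoef v (~~ odd i.+1) i.+1 =
      4 / `|entry v k' - entry v i.+1| := xicoef_gap v_incr iN.
  set D := `|_| in gap *.
  have D0 : 0 < D := entry_gap_gt0 v_incr iN.
  pose L tau := band_length b (tau *: v) (i%:Z - N%:Z).
  exists (fun tau => L tau * tau * D - 4).
    apply: (bigO_pinfty (C := 2 * C * D) (T := T)) => tau Tt; have t0 := tau_gt0 _ Tt.
    rewrite [`|tau^-1|]gtr0_norm ?invr_gt0//.
    rewrite (_ : _ - _ = (tau * D) * (L tau - 4 / D / tau)); last first.
      by field; rewrite !gt_eqF.
    have := length_approx tau i Tt; rewrite gap -/(L tau) => h.
    rewrite normrM gtr0_norm ?mulr_gt0//.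
    apply: (le_trans (ler_wpM2l _ h)); first by rewrite mulr_ge0 ?ltW.
    by rewrite le_eqVlt; apply/orP; left; apply/eqP; field; rewrite gt_eqF.
  exists T; split; first exact: num_real.
  by move=> tau /tau_gt0 t0; rewrite -/(L tau); field; rewrite !gt_eqF.
- apply: (bigO_pinfty (C := 2 * C) (T := T)) => tau Tt; have t0 := tau_gt0 _ Tt.
  have := length_approx tau ord_max Tt.
  rewrite (xicoef_last _ (odd _) (~~ odd (2 * N).+1)) subrr mul0r subr0.
  have -> : (ord_max : 'I_(2 * N).+1)%:Z - N%:Z = N%:Z by rewrite /=; lia.
  by rewrite [`|tau ^- 2|]gtr0_norm ?invr_gt0 ?exprn_gt0// mulrA.
pose S := \sum_i `|v ord0 i|.
have vS i : `|v ord0 i| <= S.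
  by rewrite /S (bigD1 i)//= lerDl; apply: sumr_ge0.
pose B := (2 * N).+1%:R * (2 ^+ 2 * inv_gaps v).
(* The term [C * S] excludes flatness below the top band; the last term makes [tau] times any gap of
   [v] at least [B + C + 4], for the top band. *)
exists (T + C * S + inv_gaps v * (B + C + 4)); split; first exact: num_real.
have G0 := inv_gaps_ge0 v.
have S0 : 0 <= S := sumr_ge0 _ (fun i _ => normr_ge0 _).
have B0 : 0 <= B by rewrite mulr_ge0// mulr_ge0// sqr_ge0.
have P1 : 0 <= C * S by rewrite mulr_ge0.
have P2 : 0 <= inv_gaps v * (B + C + 4) by rewrite mulr_ge0//; lra.
move=> tau tauT j jN; have Tt : T < tau by lra.
have t0 := tau_gt0 _ Tt.
have [i -> _] := band_index jN => -[c flat].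
have [iN|iN] := ltnP i (2 * N).
(* The two extremal shifts differ by [4 / D] in modulus. Flatness would give [4 / D <= 2 * C / tau],
   and [D <= 2 * S] then yields [tau <= C * S]. *)
- have [s0 s0I hs0] := second_order_attained b v i (odd i.+1).
  have [s1 s1I hs1] := second_order_attained b v i (~~ odd i.+1).
  have := approx tau s0 i Tt; have := approx tau s1 i Tt.
  rewrite !flat// hs0 hs1 => h1 h0.
  have h : `|(xicoef v (odd i.+1) i.+1 - xicoef v (~~ odd i.+1) i.+1) / tau| <= 2 * (C / tau ^+ 2).
    move: h0 h1; rewrite !ler_norml mulrBl => /andP[? ?] /andP[? ?].
    by apply/andP; split; lra.
  move: h; rewrite (xicoef_gap v_incr iN); set k' := if _ then _ else _.
  set D := `|_ - _| => h.
  have D2 : D <= 2 * S.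
    have := vS (inord k'.-1); have := vS (inord i).
    have := ler_normB (entry v k') (entry v i.+1).
    by rewrite -/D /entry /=; lra.
  have D0 : 0 < D := entry_gap_gt0 v_incr iN.
  move: h; rewrite ger0_norm ?divr_ge0 ?(ltW D0) ?(ltW t0)//.
  rewrite expr2 invfM !mulrA ler_pM2r ?invr_gt0// ler_pdivrMr//.
  rewrite mulrAC ler_pdivlMr// => h.
  have : 2 * C * D <= 2 * C * (2 * S) by rewrite ler_wpM2l// mulr_ge0.
  by lra.
- have iE : i = (2 * N)%N :> nat by apply/eqP; rewrite eqn_leq iN -ltnS ltn_ord.
  have o : odd (2 * N).-1 by rewrite -subn1 oddB ?muln_gt0// oddM.
  (* The entry a_(p-2) is 0 at [s0] and 2 at [s1], while flatness makes [c] an eigenvalue at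
     both. *)
  have [s0 s0I hs0] := jacobi_offdiag_attained b false o.
  have [s1 s1I hs1] := jacobi_offdiag_attained b true o.
  have mem t : t \in `[0, 2 * pi] ->
      c \in sorted_eigenvalues (jacobi b (tau *: v) t).
    move=> /flat <-; rewrite /band_fun subrK mem_nth//.
    by have [_ -> _] := sorted_eigenvaluesP (tr_jacobi b (tau *: v) t); exact: ltn_ord.
  apply: (top_band_not_constant (u := tau *: v) (l := c) N_ge1 _ hs0 _ (mem _ s0I) (mem _ s1I)).
    move=> k kN.
    have := approx tau s0 i Tt; rewrite flat//.
    have := second_order_le v i (jacobi0_le2 b s0); rewrite -/B.
    have ki : v ord0 (inord k.-1) < v ord0 i.
      exact: entry_lt_last.
    have := inv_gaps_mul_ge1 ki.
    have -> : entry (tau *: v) k = tau * entry v k by rewrite /entry mxE.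
    have -> : entry v i.+1 = v ord0 i by rewrite /entry /= inord_val.
    rewrite -[v ord0 (inord k.-1)]/(entry v k).
    set d := v ord0 i - _; set xi := second_order _ _ _ => dG xiB near_c.
    have d0 : 0 < d by rewrite subr_gt0.
    have t1 : 1 <= tau by lra.
    have hC : `|C / tau ^+ 2| <= C.
      by rewrite expr2 invfM mulrA; do 2!apply: ler_norm_divl => //; rewrite ger0_norm.
    have hxi := ler_norm_divl t1 xiB.
    (* [c] differs from [tau] v_p by at most [B + C], so this gap leaves it at least 4 above [tau]
       v_k. *)
    have key : B + C + 4 <= tau * d.
      apply: (@le_trans _ _ (inv_gaps v * (B + C + 4) * d)).
        by rewrite mulrAC ler_peMl//; lra.
      by rewrite ler_pM2r//; lra.
    move: hC hxi near_c key; rewrite /d mulrBr !ler_norml.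
    by move=> /andP[? ?] /andP[? ?] /andP[? ?] ?; lra.
  by rewrite hs1; lra.
Qed.
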